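(* Let $C:y=y(x)$ be a smooth regular curve in $A^2$, and let $$e_1=\begin{pmatrix}\dfrac{\sqrt3\,y_{xx}}{|3y_{xx}y_{xxxx}-5y_{xxx}^2|^{1/2}}\\[2ex] \dfrac{\sqrt3\,y_xy_{xx}}{|3y_{xx}y_{xxxx}-5y_{xxx}^2|^{1/2}}\end{pmatrix},\qquad e_2=\begin{pmatrix}-\dfrac{y_{xx}y_{xxx}}{|3y_{xx}y_{xxxx}-5y_{xxx}^2|}\\[2ex] -\dfrac{y_{xx}(y_xy_{xxx}-3y_{xx}^2)}{|3y_{xx}y_{xxxx}-5y_{xxx}^2|}\end{pmatrix}$$ be the left moving frame of $C$. Then the moving equation of the left moving frame is $$\frac{d}{ds}(e_1,e_2)=(e_1,e_2)\begin{pmatrix}-\frac12k(s)&-\frac13\sigma\\ 1&-k(s)\end{pmatrix}.$$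
   Context: $A^2$ is the real affine plane with affine coordinates $(x,y)$. Subscripts $x$ denote derivatives of $y(x)$. A smooth curve $y=y(x)$ is regular if $S_1=y_{xx}\neq0$ and $S_2=3y_{xx}y_{xxxx}-5y_{xxx}^2\neq0$ at all of its points. For a regular curve, $\sigma=\mathrm{sgn}(S_2)\in\{1,-1\}$; the invariant arc element is $ds=\frac{|S_2|^{1/2}}{\sqrt3\,y_{xx}}dx$, so $\frac{d}{ds}=\frac{\sqrt3\,y_{xx}}{|S_2|^{1/2}}\frac{d}{dx}$; and the curvature is $$k=\frac{\sqrt3\,(9y_{xx}^2y_{xxxxx}-45y_{xx}y_{xxx}y_{xxxx}+40y_{xxx}^3)}{3|S_2|^{3/2}},$$ written $k(s)$ as a function of the arc parameter $s$. Here $(e_1,e_2)$ denotes the $2\times2$ matrix with columns $e_1,e_2$.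
   Formalization: The curvature k is taken as σ times the printed formula (denominator 3 S_2 |S_2|^{1/2} instead of 3|S_2|^{3/2}); as printed the moving equation fails when S_2<0, e.g. for y=e^x, where it forces k=-√(2/3) but the formula gives +√(2/3). *)

(* Defs.v *)
From HB Require Import structures.
From mathcomp Require Import all_boot all_order all_algebra.
From mathcomp Require Import all_classical all_reals all_analysis.

Set Implicit Arguments.
Unset Strict Implicit.
Unset Printing Implicit Defensive.

Import Order.TTheory GRing.Theory Num.Theory.
Import numFieldNormedType.Exports.

Local Open Scope classical_set_scope.
Local Open Scope ring_scope.

Definition smooth_on (R : realType) (I : set R) (y : R -> R) : Prop :=
  forall (n : nat) (x : R), I x -> derivable (derive1n n y) x 1.

(* The graph of y over an open interval I, bounded or not. *)
Definition smooth_curve (R : realType) (I : set R) (y : R -> R) : Prop :=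
  [/\ open I, is_interval I & smooth_on I y].

Definition S1 (R : realType) (y : R -> R) (x : R) : R := derive1n 2 y x.

Definition S2 (R : realType) (y : R -> R) (x : R) : R :=
  3 * derive1n 2 y x * derive1n 4 y x - 5 * derive1n 3 y x ^+ 2.

Definition regular_curve (R : realType) (I : set R) (y : R -> R) : Prop :=
  forall x : R, I x -> S1 y x != 0 /\ S2 y x != 0.

Definition sigma (R : realType) (y : R -> R) (x : R) : R := Num.sg (S2 y x).

(* d/ds = sqrt 3 * y_xx / |S2|^(1/2) * d/dx, for V-valued functions on the
   curve, viewed as functions of the abscissa x; note that ds/dx has the sign
   of y_xx. *)
Definition d_ds (R : realType) (V : normedModType R) (y : R -> R)
    (F : R -> V) (x : R) : V :=
  (Num.sqrt 3 * derive1n 2 y x / Num.sqrt `|S2 y x|) *: derive1 F x.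

(* The curvature k at the point of abscissa x, i.e. k(s) for s = s(x).
   The factor sigma (equivalently, the denominator 3 * S2 * |S2|^(1/2) instead
   of 3 * |S2|^(3/2)) is required by the moving equation: e1 and e2 are linearly
   independent, so that equation determines k.  For y = exp, where S2 < 0, the
   formula without sigma gives sqrt (2/3), whereas the frame e1, e2 has
   k = - sqrt (2/3).  When S2 > 0 the two formulas agree. *)
Definition curvature (R : realType) (y : R -> R) (x : R) : R :=
  sigma y x *
  (Num.sqrt 3 *
     (9 * derive1n 2 y x ^+ 2 * derive1n 5 y x
      - 45 * derive1n 2 y x * derive1n 3 y x * derive1n 4 y x
      + 40 * derive1n 3 y x ^+ 3)
   / (3 * `|S2 y x| `^ (3 / 2))).

Definition col2 (R : realType) (a b : R) : 'cV[R]_2 :=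
  \col_(i < 2) if i == 0 then a else b.

Definition mx2 (R : realType) (a b c d : R) : 'M[R]_2 :=
  \matrix_(i < 2, j < 2)
    if i == 0 then (if j == 0 then a else b) else (if j == 0 then c else d).

Definition e1 (R : realType) (y : R -> R) (x : R) : 'cV[R]_2 :=
  col2 (Num.sqrt 3 * derive1n 2 y x
          / Num.sqrt `|3 * derive1n 2 y x * derive1n 4 y x
                       - 5 * derive1n 3 y x ^+ 2|)
       (Num.sqrt 3 * derive1n 1 y x * derive1n 2 y x
          / Num.sqrt `|3 * derive1n 2 y x * derive1n 4 y x
                       - 5 * derive1n 3 y x ^+ 2|).

Definition e2 (R : realType) (y : R -> R) (x : R) : 'cV[R]_2 :=
  col2 (- (derive1n 2 y x * derive1n 3 y x
             / `|3 * derive1n 2 y x * derive1n 4 y x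
                 - 5 * derive1n 3 y x ^+ 2|))
       (- (derive1n 2 y x
             * (derive1n 1 y x * derive1n 3 y x - 3 * derive1n 2 y x ^+ 2)
             / `|3 * derive1n 2 y x * derive1n 4 y x
                 - 5 * derive1n 3 y x ^+ 2|)).

(* The matrix (e1, e2) with columns e1 and e2; 1 + 1 is convertible to 2. *)
Definition left_frame (R : realType) (y : R -> R) (x : R) : 'M[R]_2 :=
  row_mx (e1 y x) (e2 y x) : 'M[R]_(2, 1 + 1).

(* Main.v *)
Require Import Defs.
From HB Require Import structures.
From mathcomp Require Import all_boot all_order all_algebra.
From mathcomp Require Import all_classical all_reals all_analysis.
From mathcomp Require Import ring.

Import Order.TTheory GRing.Theory Num.Theory.
Import numFieldNormedType.Exports.

Local Open Scope classical_set_scope.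
Local Open Scope ring_scope.

(** Write t = (1, y_x) and n = (0, 1), the tangent and the vertical direction.
In this basis the frame is triangular,
  e1 = al t,   e2 = be t + ga n,
with al = sqrt 3 y_xx / q, be = - y_xx y_xxx / q^2, ga = 3 y_xx^3 / q^2 and
q = |S2|^(1/2) ([left_frameE]).  Since dt/dx = y_xx n, dn/dx = 0 and
d/ds = al d/dx, the first coordinate y_x drops out of the problem, and the
moving equation splits into its components along t and n:
  al al' = - k/2 al + be,            al y_xx al = ga,
  al be' = - sigma/3 al - k be,      al (y_xx be + ga') = - k ga.
These four scalar identities hold pointwise for purely algebraic reasons.  On
the locus where S2 != 0 one has |S2| = sigma S2, so q is differentiable with
q' = sigma S2' / (2 q) ([is_derive_sqrt_norm]); the y_xxx y_xxxx terms of S2'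
combine into S2' = 3 y_xx y_5 - 7 y_xxx y_xxxx ([is_derive_S2]).  What
remains is an identity between rational functions of y_xx, y_xxx, y_xxxx, y_5,
q, sigma and sqrt 3, subject to sigma^2 = 1, (sqrt 3)^2 = 3 and
S2 = sigma q^2 ([structure_equations]). *)

(* The orders of differentiation below are numerals, which simplification
   would otherwise unfold into nested first derivatives. *)
#[local] Arguments derive1n : simpl never.

(** A pointwise criterion in the form that typeclass resolution and
[derive_val] can use: the entries carry the value of the derivative. *)
Lemma is_derive_mx {R : realType} (m n : nat) (M : R -> 'M[R]_(m, n))
    (dM : 'M[R]_(m, n)) (x : R) :
  (forall i j, is_derive x 1 (fun t => M t i j) (dM i j)) ->
  is_derive x 1 M dM.
Proof.
move=> dMij.
have Mx : derivable M x 1 by apply/derivable_mxP => i j; case: (dMij i j).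
apply: DeriveDef => //; rewrite derive_mx//.
by apply/matrixP => i j; rewrite mxE; case: (dMij i j).
Qed.

(** Where f does not vanish its sign is locally constant, so near x the
absolute value |f| is the constant multiple sg (f x) f, and the square root is
taken away from its singularity at 0. *)
Lemma is_derive_sqrt_norm {R : realType} (f : R -> R) (x df : R) :
  is_derive x 1 f df -> f x != 0 ->
  is_derive x 1 (fun t => Num.sqrt `|f t|)
    (Num.sg (f x) * df / (2 * Num.sqrt `|f x|)).
Proof.
move=> fx fx0.
have fcont : {for x, continuous f}.
  by apply/differentiable_continuous/derivable1_diffP; case: fx.
have near_norm : \forall t \near x, Num.sg (f x) * f t = `|f t|.
  case: (ltgtP (f x) 0) fx0 => // [fx_lt0|fx_gt0] _.
  - near=> t; rewrite ltr0_sg// mulN1r ltr0_norm//.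
    by near: t; exact: (cvgr_lt _ fcont).
  - near=> t; rewrite gtr0_sg// mul1r gtr0_norm//.
    by near: t; exact: (cvgr_gt _ fcont).
have norm' : is_derive x 1 (fun t => `|f t|) (Num.sg (f x) * df).
  by apply: (near_eq_is_derive near_norm); exact: is_deriveZ.
have sqrt' : is_derive `|f x| 1 (@Num.sqrt R) (2 * Num.sqrt `|f x|)^-1.
  by apply: is_derive1_sqrt; rewrite normr_gt0.
by rewrite mulrC; exact: (@is_derive1_comp _ _ (fun t => `|f t|)).
Unshelve. all: by end_near. Qed.

Lemma mulmx2 {R : realType} (a b c d a' b' c' d' : R) :
  mx2 a b c d *m mx2 a' b' c' d' =
  mx2 (a * a' + b * c') (a * b' + b * d')
      (c * a' + d * c') (c * b' + d * d').
Proof.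
apply/matrixP => i j; rewrite !mxE !big_ord_recl big_ord0 !mxE /= addr0.
by case: ifP; case: ifP.
Qed.

Lemma scale_mx2 {R : realType} (k a b c d : R) :
  k *: mx2 a b c d = mx2 (k * a) (k * b) (k * c) (k * d).
Proof. by apply/matrixP => i j; rewrite !mxE; case: ifP; case: ifP. Qed.

Lemma is_derive_mx2 {R : realType} {a b c d : R -> R} {x da db dc dd : R} :
  is_derive x 1 a da -> is_derive x 1 b db ->
  is_derive x 1 c dc -> is_derive x 1 d dd ->
  is_derive x 1 (fun t => mx2 (a t) (b t) (c t) (d t)) (mx2 da db dc dd).
Proof.
move=> ? ? ? ?; apply: is_derive_mx => i j; rewrite mxE.
under eq_fun do rewrite mxE.
by case: ifP => _; case: ifP.
Qed.

(** The coefficients of e1 and e2 on the tangent t = (1, y_x) and on the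
vertical n = (0, 1).  The first one is also dx/ds.  They are written with
powers of the inverse of |S2|^(1/2) alone, so that a single
quotient rule, [is_derive_divX], differentiates all three. *)
Definition e1_tangent {R : realType} (y : R -> R) (x : R) : R :=
  Num.sqrt 3 * derive1n 2 y x * (Num.sqrt `|S2 y x|)^-1.

Definition e2_tangent {R : realType} (y : R -> R) (x : R) : R :=
  - (derive1n 2 y x * derive1n 3 y x * (Num.sqrt `|S2 y x|)^-1 ^+ 2).

Definition e2_vertical {R : realType} (y : R -> R) (x : R) : R :=
  3 * derive1n 2 y x ^+ 3 * (Num.sqrt `|S2 y x|)^-1 ^+ 2.

(** The entries here are those of the triangular change of basis from (t, n) to
(e1, e2), multiplied on the left by the matrix with columns t and n. *)
Lemma left_frameE {R : realType} (y : R -> R) (x : R) :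
  left_frame y x =
  mx2 (e1_tangent y x) (e2_tangent y x)
      (derive1n 1 y x * e1_tangent y x)
      (derive1n 1 y x * e2_tangent y x + e2_vertical y x).
Proof.
have frame_l i : left_frame y x i (lshift 1 (0 : 'I_1)) = e1 y x i 0.
  exact: (row_mxEl (e1 y x) (e2 y x)).
have frame_r i : left_frame y x i (rshift 1 (0 : 'I_1)) = e2 y x i 0.
  exact: (row_mxEr (e1 y x) (e2 y x)).
have normE : `|S2 y x|^-1 = (Num.sqrt `|S2 y x|)^-1 ^+ 2.
  by rewrite exprVn sqr_sqrtr.
apply/matrixP => i j.
case: (altP (j =P 0)) => [->|j0].
  have -> : (0 : 'I_2) = lshift 1 (0 : 'I_1) by apply: val_inj.
  rewrite frame_l !mxE /e1_tangent /S2 /=.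
  by case: ifP => _; ring.
rewrite [RHS]mxE (negbTE j0).
have -> : j = rshift 1 (0 : 'I_1) by case: j j0 => [[|[|]]] // ? _; exact: val_inj.
rewrite frame_r !mxE /= /e2_tangent /e2_vertical.
rewrite -normE /S2.
move: (_^-1) => w; move: (derive1n 1 y x) (derive1n 2 y x) (derive1n 3 y x) => u a b.
by case: ifP => _; ring.
Qed.

Lemma is_derive_derive1n {R : realType} (I : set R) (y : R -> R) (n : nat) (x : R) :
  smooth_on I y -> I x ->
  is_derive x 1 (derive1n n y) (derive1n n.+1 y x).
Proof. by move=> ys Ix; rewrite derive1nS derive1E; apply/derivableP/ys. Qed.

Lemma is_derive_S2 {R : realType} (I : set R) (y : R -> R) (x : R) :
  smooth_on I y -> I x ->
  is_derive x 1 (S2 y)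
    (3 * derive1n 2 y x * derive1n 5 y x
     - 7 * derive1n 3 y x * derive1n 4 y x).
Proof.
move=> ys Ix; have dn n := is_derive_derive1n I y n x ys Ix.
have S2E : S2 y = 3 *: (derive1n 2 y * derive1n 4 y) - 5 *: derive1n 3 y ^+ 2.
  by apply/funext => t; rewrite /S2 -mulrA.
rewrite S2E; apply: is_derive_eq.
move: (derive1n 2 y x) (derive1n 3 y x) (derive1n 4 y x) (derive1n 5 y x) => a b c d.
rewrite /GRing.scale /=; ring.
Qed.

(** The exponent 3/2 becomes a polynomial expression in q = |S2|^(1/2), the
variable in which the structure equations are rational. *)
Lemma curvatureE {R : realType} (y : R -> R) (x : R) :
  curvature y x =
  sigma y x *
  (Num.sqrt 3 *
     (9 * derive1n 2 y x ^+ 2 * derive1n 5 y x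
      - 45 * derive1n 2 y x * derive1n 3 y x * derive1n 4 y x
      + 40 * derive1n 3 y x ^+ 3)
   / (3 * Num.sqrt `|S2 y x| ^+ 3)).
Proof.
rewrite /curvature; have -> : 3 / 2 = 2^-1 * 3%:R :> R by rewrite mulrC.
by rewrite powRrM powR12_sqrt// powR_mulrn// sqrtr_ge0.
Qed.

Lemma is_derive_divX {R : realType} (f q : R -> R) (n : nat) (x df dq : R) :
  is_derive x 1 f df -> is_derive x 1 q dq -> q x != 0 ->
  is_derive x 1 (fun t => f t * (q t)^-1 ^+ n.+1)
    (df * (q x)^-1 ^+ n.+1 - n.+1%:R * f x * dq * (q x)^-1 ^+ n.+2).
Proof.
move=> fx qx q0.
have qV : is_derive x 1 (fun t => (q t)^-1) (- (q x) ^- 2 *: dq).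
  exact: is_deriveV.
have -> : (fun t => f t * (q t)^-1 ^+ n.+1) = f * (fun t => (q t)^-1) ^+ n.+1.
  by apply/funext => t; rewrite [RHS]/GRing.mul /= exprfctE.
apply: is_derive_eq; rewrite /GRing.scale /= -exprVn.
by rewrite exprfctE; move: (q x)^-1 => w; rewrite !exprS; ring.
Qed.

(** The moving equation in the basis (t, n), as an identity in the jet
coordinates a, b, c, d = y_xx, y_xxx, y_xxxx, y_5.  The numbers dal, dbe and dga
are the derivatives of al, be and ga given by the quotient rule.
Eliminating c through 3 a c - 5 b^2 = s q^2 turns each equation into an
identity of polynomials modulo r^2 = 3 and s^2 = 1; a != 0 makes the elimination
possible. *)
Lemma structure_equations {F : numFieldType} (r q s k a b c d dq : F) :
  r ^+ 2 = 3 -> s ^+ 2 = 1 -> q != 0 -> a != 0 ->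
  3 * a * c - 5 * b ^+ 2 = s * q ^+ 2 ->
  dq = s * (3 * a * d - 7 * b * c) / (2 * q) ->
  k = s * (r * (9 * a ^+ 2 * d - 45 * a * b * c + 40 * b ^+ 3)
           / (3 * q ^+ 3)) ->
  let al := r * a * q^-1 in
  let be := - (a * b * q^-1 ^+ 2) in
  let ga := 3 * a ^+ 3 * q^-1 ^+ 2 in
  let dal := r * b * q^-1 - 1 * (r * a) * dq * q^-1 ^+ 2 in
  let dbe := - ((a * c + b * b) * q^-1 ^+ 2
                - 2 * (a * b) * dq * q^-1 ^+ 3) in
  let dga := 9 * a ^+ 2 * b * q^-1 ^+ 2
             - 2 * (3 * a ^+ 3) * dq * q^-1 ^+ 3 in
  [/\ al * dal = - (1 / 2 * k) * al + be,
      al * dbe = - (1 / 3 * s) * al - k * be,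
      al * (a * al) = ga &
      al * (a * be + dga) = - k * ga].
Proof.
move=> r2 s2 q0 a0 S2q -> -> /=.
have -> : c = (s * q ^+ 2 + 5 * b ^+ 2) / (3 * a) by rewrite -S2q; field.
by split; field: r2 s2; rewrite q0 ?a0.
Qed.

(** The structure equations along the curve.  The derivatives appear through an
existential because only these four relations, and not their explicit
formulas, enter the moving equation. *)
Lemma frame_coefficients_derive {R : realType} (I : set R) (y : R -> R) (x : R) :
  smooth_on I y -> regular_curve I y -> I x ->
  exists dal dbe dga : R,
    [/\ is_derive x 1 (e1_tangent y) dal,
        is_derive x 1 (e2_tangent y) dbe &
        is_derive x 1 (e2_vertical y) dga] /\
    [/\ e1_tangent y x * dal
          = - (1 / 2 * curvature y x) * e1_tangent y x + e2_tangent y x,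
        e1_tangent y x * dbe
          = - (1 / 3 * sigma y x) * e1_tangent y x
            - curvature y x * e2_tangent y x,
        e1_tangent y x * (derive1n 2 y x * e1_tangent y x)
          = e2_vertical y x &
        e1_tangent y x * (derive1n 2 y x * e2_tangent y x + dga)
          = - curvature y x * e2_vertical y x].
Proof.
move=> ys hreg Ix; have [a0 S0] := hreg _ Ix.
have dn n := is_derive_derive1n I y n x ys Ix.
have q0 : Num.sqrt `|S2 y x| != 0 by rewrite gt_eqF// sqrtr_gt0 normr_gt0.
have dq := is_derive_sqrt_norm (S2 y) x _ (is_derive_S2 I y x ys Ix) S0.
have S2q : S2 y x = sigma y x * Num.sqrt `|S2 y x| ^+ 2.
  by rewrite sqr_sqrtr// /sigma -numEsg.
have sg2 : sigma y x ^+ 2 = 1 by rewrite /sigma sqr_sg S0.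
have r2 : Num.sqrt 3 ^+ 2 = 3 :> R by rewrite sqr_sqrtr.
have [] := structure_equations _ _ _ _ _ _ _ _ _ r2 sg2 q0 a0 S2q erefl
  (curvatureE y x).
set dal := (X in _ * X = _); set dbe := (X in _ * X = - (1/3 * _) * _ - _).
set dga := (X in _ * (_ + X) = _).
move=> eq_al eq_be eq_ga eq_ve; exists dal, dbe, dga; split=> //; split.
- exact: is_derive_divX _ _ 0 x _ _ (is_deriveZ _ (dn 2%N)) dq q0.
- apply: is_deriveN.
  exact: is_derive_divX _ _ 1 x _ _ (is_deriveM (dn 2%N) (dn 3%N)) dq q0.
- have a3' : is_derive x 1 (fun t => 3 * derive1n 2 y t ^+ 3)
      (9 * derive1n 2 y x ^+ 2 * derive1n 3 y x).
    have -> : (fun t => 3 * derive1n 2 y t ^+ 3) = 3 *: derive1n 2 y ^+ 3.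
      by apply/funext => t; rewrite [RHS]/GRing.scale /= exprfctE.
    apply: is_derive_eq; rewrite /GRing.scale /=.
    by move: (derive1n 2 y x) (derive1n 3 y x) => a b; ring.
  exact: is_derive_divX _ _ 1 x _ _ a3' dq q0.
Qed.

Theorem theorem4p3 (R : realType) (I : set R) (y : R -> R)
    (hC : smooth_curve I y) (hreg : regular_curve I y) :
  forall x : R, I x ->
    derivable (left_frame y) x 1 /\
    d_ds y (left_frame y) x =
      left_frame y x *m
        mx2 (- (1 / 2 * curvature y x)) (- (1 / 3 * sigma y x))
            1                           (- curvature y x).
Proof.
move=> x Ix; have [_ _ ys] := hC.
have u' := is_derive_derive1n I y 1%N x ys Ix.
have [dal [dbe [dga [[al' be' ga'] [eq_al eq_be eq_ga eq_ve]]]]] :=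
  frame_coefficients_derive I y x ys hreg Ix.
have frame' : is_derive x 1 (left_frame y)
    (mx2 dal dbe
       (derive1n 1 y x * dal + e1_tangent y x * derive1n 2 y x)
       (derive1n 1 y x * dbe + e2_tangent y x * derive1n 2 y x + dga)).
  rewrite (funext (left_frameE y)).
  exact: is_derive_mx2 al' be' (is_deriveM u' al')
    (is_deriveD (is_deriveM u' be') ga').
split; first by case: frame'.
rewrite /d_ds derive1E derive_val left_frameE mulmx2 -/(e1_tangent y x).
rewrite scale_mx2.
move: (e1_tangent y x) (e2_tangent y x) (e2_vertical y x) (curvature y x)
  (sigma y x) (derive1n 1 y x) (derive1n 2 y x) eq_al eq_be eq_ga eq_ve
  => al be ga k s u a eq_al eq_be eq_ga eq_ve.
(* The first row is the t-component of the equation; the second row is y_x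
   times the first plus the n-component. *)
congr mx2.
- by rewrite eq_al; ring.
- by rewrite eq_be; ring.
- have -> : al * (u * dal + al * a) = u * (al * dal) + al * (a * al) by ring.
  by rewrite eq_al eq_ga; ring.
- have -> : al * (u * dbe + be * a + dga) = u * (al * dbe) + al * (a * be + dga).
    by ring.
  by rewrite eq_be eq_ve; ring.
Qed.
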